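(* Let $n\ge1$ and let $A$ be a real $n\times n$ matrix such that $n-1$ of its rows are identical. Then $\operatorname{dih}(A)=0$.
   Context: For $n\ge1$ and $k=1,\dots,n$, let $\rho_k$ be the permutation of $\{1,\dots,n\}$ with $\rho_k(1)=k,\rho_k(2)=k+1,\dots,\rho_k(n-k+1)=n,\rho_k(n-k+2)=1,\dots,\rho_k(n)=k-1$, and let $\mu_k$ be the permutation with $\mu_k(1)=k,\mu_k(2)=k-1,\dots,\mu_k(k)=1,\mu_k(k+1)=n,\mu_k(k+2)=n-1,\dots,\mu_k(n)=k+1$. For an $n\times n$ matrix $A=(a_{i,j})$, the dihedrant is $$\operatorname{dih}(A)=\sum_{k=1}^n\prod_{i=1}^n a_{i,\rho_k(i)}-\sum_{k=1}^n\prod_{i=1}^n a_{i,\mu_k(i)}.$$ *)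

(* Defs.v *)
From mathcomp Require Import all_boot all_order all_algebra all_fingroup.
From mathcomp Require Import reals zify.

Set Implicit Arguments.
Unset Strict Implicit.
Unset Printing Implicit Defensive.

(* Indices are shifted to start at 0: the 1-based value rho_k(i), with           *)
(* k = k0 + 1 and i = i0 + 1, is (rho_val n k0 i0) + 1; likewise for mu_k(i).    *)

Definition rho_val (n k i : nat) : nat :=
  if i + k < n then i + k else i + k - n.

Definition mu_val (n k i : nat) : nat :=
  if i <= k then k - i else n + k - i.

Lemma rho_val_lt (n : nat) (k i : 'I_n) : rho_val n k i < n.
Proof. by rewrite /rho_val; case: ifP; have := ltn_ord k; have := ltn_ord i; lia. Qed.

Lemma mu_val_lt (n : nat) (k i : 'I_n) : mu_val n k i < n.
Proof. by rewrite /mu_val; case: ifP; have := ltn_ord k; have := ltn_ord i; lia. Qed.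

Definition rho_fun (n : nat) (k i : 'I_n) : 'I_n := Ordinal (rho_val_lt k i).

Definition mu_fun (n : nat) (k i : 'I_n) : 'I_n := Ordinal (mu_val_lt k i).

Lemma rho_fun_inj (n : nat) (k : 'I_n) : injective (rho_fun k).
Proof.
move=> i j /(congr1 val); rewrite /= /rho_val => e; apply: val_inj => /=.
by move: e; have := ltn_ord k; have := ltn_ord i; have := ltn_ord j; do 2 case: ifP; lia.
Qed.

Lemma mu_fun_inj (n : nat) (k : 'I_n) : injective (mu_fun k).
Proof.
move=> i j /(congr1 val); rewrite /= /mu_val => e; apply: val_inj => /=.
by move: e; have := ltn_ord k; have := ltn_ord i; have := ltn_ord j; do 2 case: ifP; lia.
Qed.

Definition rho (n : nat) (k : 'I_n) : 'S_n := perm (@rho_fun_inj n k).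

Definition mu (n : nat) (k : 'I_n) : 'S_n := perm (@mu_fun_inj n k).

Local Open Scope ring_scope.

Definition dih (R : realType) (n : nat) (A : 'M[R]_n) : R :=
  \sum_(k < n) \prod_(i < n) A i (rho k i)
  - \sum_(k < n) \prod_(i < n) A i (mu k i).

(* Main.v *)
Require Import Defs.
From mathcomp Require Import all_boot all_order all_algebra all_fingroup.
From mathcomp Require Import reals zify.

Local Open Scope ring_scope.

(** If all rows but row [i0] equal [b], the product along a permutation [s]
    depends only on [s i0]. Both the rotations and the reflections send [i0] to
    each column exactly once, so the two sums in the dihedrant coincide. *)

Lemma prod_perm_rowD1 (R : comPzRingType) (n : nat) (A : 'M[R]_n) (b : 'rV[R]_n)
    (i0 : 'I_n) (s : 'S_n) :
  (forall i, i != i0 -> row i A = b) ->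
  \prod_(i < n) A i (s i) = A i0 (s i0) * \prod_(j < n | j != s i0) b ord0 j.
Proof.
move=> Ab; rewrite (bigD1 i0) //=; congr (_ * _).
(* Substituting [j = s i] turns the columns other than [s i0] into the rows other than [i0]. *)
rewrite [RHS](reindex_inj (@perm_inj _ s)) /=.
apply: eq_big => [i|i ni0]; first by rewrite (inj_eq perm_inj).
by rewrite -(Ab i ni0) mxE.
Qed.

(** An injection of ['I_n] into itself is a bijection, so [j = f k i0] reindexes the sum. The result
    is free of [f], which lets two families be compared. *)
Lemma sum_prod_perm_rowD1 (R : comPzRingType) (n : nat) (A : 'M[R]_n)
    (b : 'rV[R]_n) (i0 : 'I_n) (f : 'I_n -> 'S_n) :
  (forall i, i != i0 -> row i A = b) -> injective (f^~ i0) ->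
  \sum_(k < n) \prod_(i < n) A i (f k i) =
  \sum_(j < n) A i0 j * \prod_(l < n | l != j) b ord0 l.
Proof.
move=> Ab f_inj; rewrite [RHS](reindex_inj f_inj) /=.
by apply: eq_bigr => k _; apply: prod_perm_rowD1.
Qed.

(** Modulo [n], [rho k i] is [k + i] and [mu k i] is [k - i]: both are translations in [k]. *)
Lemma rho_index_inj (n : nat) (i : 'I_n) : injective ((@rho n)^~ i).
Proof.
move=> k l; rewrite !permE => /(congr1 val); rewrite /= /rho_val => e.
apply: val_inj => /=; move: e.
by have := ltn_ord k; have := ltn_ord l; have := ltn_ord i; do 2 case: ifP; lia.
Qed.

Lemma mu_index_inj (n : nat) (i : 'I_n) : injective ((@mu n)^~ i).
Proof.
move=> k l; rewrite !permE => /(congr1 val); rewrite /= /mu_val => e.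
apply: val_inj => /=; move: e.
by have := ltn_ord k; have := ltn_ord l; have := ltn_ord i; do 2 case: ifP; lia.
Qed.

Theorem theorem5 (R : realType) (n : nat) (hn : (1 <= n)%N) (A : 'M[R]_n)
    (hA : exists S : {set 'I_n},
        #|S| = (n - 1)%N /\ {in S &, forall i j, row i A = row j A}) :
  dih A = 0.
Proof.
have [S [cardS rowS]] := hA.
have /eqP/cards1P [i0 Si0] : #|~: S| = 1%N.
  (* Subtraction is truncated, so [1 <= n] is what makes [n - (n - 1)] equal to 1. *)
  by have := cardsC S; rewrite cardS card_ord; lia.
have inS i : i != i0 -> i \in S.
  by move=> ni0; rewrite -[S]setCK Si0 !inE.
have [b Ab] : exists b, forall i, i != i0 -> row i A = b.
  have [S0|[r rS]] := set_0Vmem S.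
    (* Here [n = 1]: no row differs from [i0], and any [b] would do. *)
    by exists 0 => i /inS; rewrite S0 inE.
  by exists (row r A) => i /inS iS; apply: rowS.
rewrite /dih (sum_prod_perm_rowD1 _ _ _ _ _ _ Ab (rho_index_inj _ i0)).
by rewrite (sum_prod_perm_rowD1 _ _ _ _ _ _ Ab (mu_index_inj _ i0)) GRing.subrr.
Qed.
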